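(* Let $\omega\subset\mathbb{R}^2$ be a bounded Lipschitz domain and let $\gamma_d$ be a relatively open, non-empty subset of the boundary $\partial\omega$. Assume that $m,y_0\in C^2(\overline{\omega},\mathbb{R}^3)$ are regular surfaces, that $Q\in C^1(\overline{\omega},\mathrm{SO}(3))$, and that $$\mathrm{D}m(x)=Q(x)\,\mathrm{D}y_0(x),\qquad Q(x)\,n_0(x)=n_0(x)\qquad\text{for all }x\in\overline{\omega},$$ $$m|_{\gamma_d}=y_0|_{\gamma_d},$$ where $n_0=\dfrac{\partial_1y_0\times\partial_2y_0}{\|\partial_1y_0\times\partial_2y_0\|}$ denotes the normal field on $y_0(\omega)$. Then $m\equiv y_0$.
   Context: A domain is an open connected set. For a map $m$ from (the closure of) $\omega\subset\mathbb{R}^2$ to $\mathbb{R}^3$, $\mathrm{D}m=(\partial_1m\,|\,\partial_2m)$ is the $3\times2$ Jacobi matrix. Such a $C^1$ map is called a regular surface if its Jacobi matrix has rank $2$ everywhere on its domain of definition (no injectivity is required). $C^k(\overline{\omega},\cdot)$ denotes maps that are $C^k$ up to the boundary, i.e. all partial derivatives up to order $k$ extend continuously to $\overline{\omega}$. $\mathrm{SO}(3)=\{X\in\mathbb{R}^{3\times3}: X^TX=I_3,\ \det X=1\}$. *)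

(* Defs.v *)
From HB Require Import structures.
From mathcomp Require Import all_boot all_order all_algebra.
From mathcomp Require Import all_classical all_reals all_analysis.

Set Implicit Arguments.
Unset Strict Implicit.
Unset Printing Implicit Defensive.

Import Order.TTheory GRing.Theory Num.Theory.
Import numFieldNormedType.Exports.

Local Open Scope classical_set_scope.
Local Open Scope ring_scope.

Definition boundary (T : topologicalType) (A : set T) : set T :=
  closure A `\` interior A.

(* Near each boundary point, after an orthogonal change of coordinates,
   [om] lies strictly below the graph of a Lipschitz function. Translations
   are absorbed in [phi]. *)
Definition lipschitz_boundary (R : realType) (om : set 'cV[R]_2) : Prop :=
  forall p, boundary om p ->
    exists (A : 'M[R]_2) (phi : R -> R) (L : R),
      [/\ A^T *m A = 1%:M,
          (forall s t, `|phi s - phi t| <= L * `|s - t|) &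
          \forall x \near p,
            om x <-> (A *m x) 1 0 < phi ((A *m x) 0 0)].

Definition bounded_lipschitz_domain (R : realType) (om : set 'cV[R]_2) : Prop :=
  [/\ open om, connected om, bounded_set om & lipschitz_boundary om].

Definition relatively_open (T : topologicalType) (S A : set T) : Prop :=
  exists2 O : set T, open O & A = S `&` O.

Definition partial (R : realType) (V : normedModType R) (i : 'I_2)
    (f : 'cV[R]_2 -> V) : 'cV[R]_2 -> V :=
  fun x => 'D_(delta_mx i 0) f x.

Definition partials (R : realType) (V : normedModType R) (s : seq 'I_2)
    (f : 'cV[R]_2 -> V) : 'cV[R]_2 -> V :=
  foldr (@partial R V) f s.

(* C^k up to the boundary. A map defined on [closure om] is represented by a
   total function whose values outside [closure om] are irrelevant. *)
Definition Ck_closure (R : realType) (V : normedModType R) (k : nat)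
    (om : set 'cV[R]_2) (f : 'cV[R]_2 -> V) : Prop :=
  {within closure om, continuous f} /\
  forall s : seq 'I_2, (size s <= k)%N ->
    ((size s < k)%N -> forall i x, om x ->
       derivable (partials s f) x (delta_mx i 0)) /\
    (exists g : 'cV[R]_2 -> V, {within closure om, continuous g} /\
       forall x, om x -> g x = partials s f x).

(* The value at [x] in [closure om] of the continuous extension of [f] from
   [om] (when this extension exists). *)
Definition extension (R : realType) (V : normedModType R)
    (om : set 'cV[R]_2) (f : 'cV[R]_2 -> V) (x : 'cV[R]_2) : V :=
  lim (f @ within om (nbhs x)).

(* (d_1 m | d_2 m), extended continuously to [closure om]. *)
Definition jacobi (R : realType) (om : set 'cV[R]_2)
    (m : 'cV[R]_2 -> 'cV[R]_3) (x : 'cV[R]_2) : 'M[R]_(3, 2) :=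
  \matrix_(i < 3, j < 2) extension om (partial j m) x i 0.

Definition regular_surface (R : realType) (om : set 'cV[R]_2)
    (m : 'cV[R]_2 -> 'cV[R]_3) : Prop :=
  Ck_closure 1 om m /\ forall x, closure om x -> \rank (jacobi om m x) = 2%N.

Definition SO3 (R : realType) : set 'M[R]_3 :=
  [set X | X^T *m X = 1%:M /\ \det X = 1].

(* Indices are in 'I_3, hence taken modulo 3. *)
Definition cross (R : realType) (u v : 'cV[R]_3) : 'cV[R]_3 :=
  \col_i (u (i + 1) 0 * v (i + 2) 0 - u (i + 2) 0 * v (i + 1) 0).

(* The library norm on 'cV[R]_3 is the maximum norm. *)
Definition euclidean_norm (R : realType) (u : 'cV[R]_3) : R :=
  Num.sqrt (\sum_i u i 0 ^+ 2).

Definition unit_normal (R : realType) (om : set 'cV[R]_2)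
    (y : 'cV[R]_2 -> 'cV[R]_3) (x : 'cV[R]_2) : 'cV[R]_3 :=
  let c := cross (col 0 (jacobi om y x)) (col 1 (jacobi om y x)) in
  (euclidean_norm c)^-1 *: c.

(* Main.v *)
(* Since [Q y0_j = m_j] and second derivatives commute, the antisymmetric
   matrices [Q^T Q_i] satisfy [Q^T Q_0 y0_1 = Q^T Q_1 y0_0]; pairing with the
   tangent vectors shows that their axial vectors are tangential. As [Q] fixes
   the normal [n0], the axial vector of [Q - Q^T] is parallel to [n0], and hence
   the derivative of [\tr Q], i.e. of the rotation angle about [n0], vanishes:
   [\tr Q] is constant.
   At a point of [gamma], [m - y0] vanishes along a Lipschitz boundary curve, so
   that its derivative [(Q - 1) Dy0] has a nontrivial kernel. There [Q] fixes a
   tangent vector besides [n0], whence [\tr Q = 3] there and thus everywhere.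
   Then [Q = 1], and [m - y0] is constant. No differentiability of the boundary
   (Rademacher) is needed: chords between nearby boundary points are replaced by
   paths of comparable length inside the domain. *)
Require Import Defs.
From HB Require Import structures.
From mathcomp Require Import all_boot all_order all_algebra.
From mathcomp Require Import all_classical all_reals all_analysis.
From mathcomp Require Import ring lra.

Set Implicit Arguments.
Unset Strict Implicit.
Unset Printing Implicit Defensive.

Import Order.TTheory GRing.Theory Num.Theory.
Import numFieldNormedType.Exports.

Local Open Scope classical_set_scope.
Local Open Scope ring_scope.

(** * Entrywise norm bounds and the mean value theorem along lines *)

Lemma mx_norm_le (R : realType) m n (M : 'M[R]_(m, n)) (e : R) :
  0 <= e -> (forall i j, `|M i j| <= e) -> `|M| <= e.
Proof.
by move=> e0 Me; rewrite /Num.Def.normr/= mx_normrE bigmax_le// => -[].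
Qed.

Lemma mx_entry_le (R : realType) m n (M : 'M[R]_(m, n)) i j : `|M i j| <= `|M|.
Proof.
rewrite [leRHS]/Num.Def.normr/= mx_normrE.
exact: (le_bigmax _ (fun ij => `|M ij.1 ij.2|) (i, j)).
Qed.

Lemma is_derive_line (R : realType) (V : normedModType R) (f : V -> R)
    (x v : V) (t d : R) :
  is_derive (x + t *: v) v f d -> is_derive t 1 (fun s => f (x + s *: v)) d.
Proof.
have E : (fun h => h^-1 *: (((fun s => f (x + s *: v)) \o shift t) (h *: (1 : R))
      - f (x + t *: v))) =
    (fun h => h^-1 *: ((f \o shift (x + t *: v)) (h *: v) - f (x + t *: v))).
  apply/funext => h /=; rewrite [h *: 1]mulr1 scalerDl.
  by rewrite addrCA.
by move=> [df <-]; split; [rewrite /derivable E | rewrite /derive E].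
Qed.

Lemma MVT_line (R : realType) (V : normedModType R) (f g : V -> R) (x v : V) :
  (forall t, t \in `]0, 1[ -> is_derive (x + t *: v) v f (g (x + t *: v))) ->
  {within `[0, 1], continuous (fun t : R => f (x + t *: v))} ->
  exists2 t, t \in `]0, 1[ & f (x + v) - f x = g (x + t *: v).
Proof.
move=> fg fc.
have [|t t01] := MVT (@ltr01 R) _ fc (df := fun t => g (x + t *: v)).
  by move=> t t01; exact/is_derive_line/fg.
by rewrite scale1r scale0r addr0 subr0 mulr1; exists t.
Qed.

Lemma MVT_line_closed (R : realType) (V : normedModType R) (f g : V -> R)
    (x v : V) :
  (forall t, t \in `[0, 1] -> is_derive (x + t *: v) v f (g (x + t *: v))) ->
  exists2 t, t \in `[0, 1] & f (x + v) - f x = g (x + t *: v).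
Proof.
move=> fg.
have fc : {within `[0, 1], continuous (fun t : R => f (x + t *: v))}.
  by apply: derivable_within_continuous => t /fg /is_derive_line[].
have [t t01 ->] := MVT_line (fun t t01 => fg t (subset_itv_oo_cc t01)) fc.
by exists t => //; exact: subset_itv_oo_cc.
Qed.

(** Chain rule for [s |-> f (x + s *: v)] composed with multiplication by [c]; in this form [c = 0]
    needs no separate treatment. *)
Lemma is_derive_dirZ (R : realType) (V : normedModType R) (f : V -> R)
    (x v : V) (c d : R) :
  is_derive x v f d -> is_derive x (c *: v) f (c * d).
Proof.
move=> fd.
have H1 : is_derive (c * 0) 1 (fun s : R => f (x + s *: v)) d.
  by rewrite mulr0; apply: is_derive_line; rewrite scale0r addr0.
have H2 : is_derive (0 : R) 1 (fun s : R => c * s) c.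
  have := @is_deriveZ R R R id c 0 1 1 (is_derive_id _ _).
  by rewrite [c *: 1]mulr1.
have [] := is_derive1_comp H1 H2.
have E : (fun h => h^-1 *: ((((fun s : R => f (x + s *: v)) \o *%R c)
     \o shift 0) (h *: (1 : R)) -
        ((fun s : R => f (x + s *: v)) \o *%R c) 0)) =
    (fun h => h^-1 *: ((f \o shift x) (h *: (c *: v)) - f x)).
  apply/funext => h /=; rewrite [h *: 1]mulr1 addr0 mulr0 scale0r addr0.
  by rewrite scalerA [h * c]mulrC [x + _]addrC.
rewrite /derivable /derive E mulrC => fcd <-.
by split.
Qed.

(** * Functions with continuous partial derivatives on an open set of the plane *)

Lemma ord2_cases (i : 'I_2) : i = 0 \/ i = 1.
Proof. by case: i => [[|[|//]] i2]; [left|right]; exact/val_inj. Qed.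

Lemma sum_ord2 (V : nmodType) (F : 'I_2 -> V) : \sum_i F i = F 0 + F 1.
Proof.
rewrite !big_ord_recl big_ord0 addr0; congr (F _ + F _); exact/val_inj.
Qed.

Lemma cV2E (R : realType) (v : 'cV[R]_2) :
  v = v 0 0 *: delta_mx 0 0 + v 1 0 *: delta_mx 1 0.
Proof.
apply/colP => i; rewrite !mxE !eqxx !andbT.
by case: (ord2_cases i) => ->; rewrite /= mulr1 mulr0 ?addr0 ?add0r.
Qed.

Lemma cV2_norm_le (R : realType) (v w : 'cV[R]_2) :
  `|v 0 0| <= `|w 0 0| -> `|v 1 0| <= `|w 1 0| -> `|v| <= `|w|.
Proof.
move=> v0 v1; apply: mx_norm_le => // i j; rewrite (ord1 j).
by case: (ord2_cases i) => ->; [apply: le_trans v0 _ | apply: le_trans v1 _];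
  exact: mx_entry_le.
Qed.

(** The derivatives are passed as functions [g], so that they can be instantiated by extensions that
    remain meaningful on the boundary. *)
Definition C1_partials (R : realType) (om : set 'cV[R]_2) (f : 'cV[R]_2 -> R)
    (g : 'I_2 -> 'cV[R]_2 -> R) : Prop :=
  forall x, om x -> forall i,
    is_derive x (delta_mx i 0) f (g i x) /\ {for x, continuous (g i)}.

(** Move from [x] to [x + w] in two axis-parallel steps and apply the mean value theorem to each.
    For the maximum norm both steps stay within distance [|w|] of [x]. *)
Lemma C1_increment (R : realType) (f : 'cV[R]_2 -> R)
    (g : 'I_2 -> 'cV[R]_2 -> R) (x w : 'cV[R]_2) (e : R) :
  (forall y, `|y - x| <= `|w| -> forall i,
     is_derive y (delta_mx i 0) f (g i y) /\ `|g i y - g i x| <= e) ->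
  `|f (x + w) - f x - \sum_i g i x * w i 0| <= e * (`|w 0 0| + `|w 1 0|).
Proof.
move=> fg; set E0 : 'cV[R]_2 := delta_mx 0 0; set E1 : 'cV[R]_2 := delta_mx 1 0.
have near_x s t : `|s| <= `|w 0 0| -> `|t| <= `|w 1 0| ->
    `|(x + s *: E0 + t *: E1) - x| <= `|w|.
  move=> sw tw; rewrite -!addrA addrC addrA subrK; apply: cV2_norm_le.
    by rewrite !mxE/= mulr0 mulr1 addr0.
  by rewrite !mxE/= mulr0 mulr1 add0r.
have scale_le (t a : R) : t \in `[0, 1] -> `|t * a| <= `|a|.
  rewrite in_itv/= => /andP[t0 t1].
  by rewrite normrM ger0_norm// ler_piMl.
have [|t1 t1P f1] := @MVT_line_closed R _ f (fun y => w 1 0 * g 1 y)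
    (x + w 0 0 *: E0) (w 1 0 *: E1).
  move=> t t01; apply/is_derive_dirZ/(fg _ _ 1).1.
  by rewrite scalerA near_x// scale_le.
have [|t0 t0P f0] := @MVT_line_closed R _ f (fun y => w 0 0 * g 0 y)
    x (w 0 0 *: E0).
  move=> t t01; apply/is_derive_dirZ/(fg _ _ 0).1.
  rewrite scalerA -[x + _]addr0 -(scale0r E1) near_x ?scale_le//.
  by rewrite normr0.
rewrite [in f (x + w)](cV2E w) addrA -/E0 -/E1 sum_ord2.
rewrite -(subrK (f (x + w 0 0 *: E0)) (f _)) f1 -(addrA _ (f _) (- f x)) f0.
set a := g 1 _; set b := g 0 _.
have -> : w 1 0 * a + w 0 0 * b - (g 0 x * w 0 0 + g 1 x * w 1 0) =
  (b - g 0 x) * w 0 0 + (a - g 1 x) * w 1 0 by ring.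
rewrite mulrDr (le_trans (ler_normD _ _))// !normrM lerD// ler_wpM2r//.
  apply: (fg _ _ 0).2.
  rewrite scalerA -[x + _]addr0 -(scale0r E1) near_x ?scale_le//.
  by rewrite normr0.
by apply: (fg _ _ 1).2; rewrite scalerA near_x// scale_le.
Qed.

(** [C1_increment] applied to [h *: v]: as [h] tends to 0, the oscillation of the partial
    derivatives along the two steps becomes arbitrarily small. *)
Lemma C1_is_derive (R : realType) (om : set 'cV[R]_2) (f : 'cV[R]_2 -> R)
    (g : 'I_2 -> 'cV[R]_2 -> R) (x v : 'cV[R]_2) :
  open om -> C1_partials om f g -> om x ->
  is_derive x v f (\sum_i g i x * v i 0).
Proof.
move=> om_open fg omx.
suff H : (fun h => h^-1 *: ((f \o shift x) (h *: v) - f x)) @ 0^' -->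
    (\sum_i g i x * v i 0 : R).
  by split; [apply/cvg_ex; eexists; exact: H | exact: cvg_lim H].
apply/cvgrPdist_le => /= eps eps0.
(* Makes [e * (|v 0 0| + |v 1 0|)] at most [eps]; the summand 1 keeps the denominator positive when
   [v = 0]. *)
pose e := eps / (`|v 0 0| + `|v 1 0| + 1).
have e0 : 0 < e by rewrite divr_gt0// ltr_wpDl// addr_ge0.
have xom : nbhs x om by exact: open_nbhs_nbhs.
have xg : nbhs x [set y | forall i, `|g i y - g i x| <= e].
  apply: (@filter_forall _ _ (fun i y => `|g i y - g i x| <= e) (nbhs x) _) => i.
  have /cvgrPdist_le/(_ _ e0) := (fg _ omx i).2.
  by apply: filterS => y; rewrite distrC.
have [r /= r0 xr] := (nbhs_ballP _ _).1 (filterI xom xg).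
near=> h.
have h0 : h != 0 by near: h; exact: nbhs_dnbhs_neq.
have hr : `|h *: v| < r.
  rewrite normrZ (@le_lt_trans _ _ (`|h| * (`|v| + 1)))//.
    by rewrite ler_wpM2l// lerDl.
  rewrite -ltr_pdivlMr ?ltr_wpDl//.
  by near: h; apply: dnbhs0_lt; rewrite divr_gt0// ltr_wpDl.
have E : f (x + h *: v) - f x - \sum_i g i x * (h *: v) i 0 =
    h * (h^-1 * (f (h *: v + x) - f x) - \sum_i g i x * v i 0).
  rewrite mulrBr mulrA divff// mul1r [x + _]addrC.
  by congr (_ - _); rewrite mulr_sumr; apply: eq_bigr => i _; rewrite mxE mulrCA.
have := @C1_increment R f g x (h *: v) e; rewrite E.
rewrite !mxE !normrM -mulrDr mulrCA ler_pM2l ?normr_gt0// distrC => H.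
apply: le_trans (H _) _.
  move=> y yx i; have [|omy gy] := xr y.
    by rewrite -ball_normE/= distrC (le_lt_trans yx).
  by split; [exact: (fg _ omy i).1|].
rewrite /e -mulrA ler_piMr ?(ltW eps0)// [_^-1 * _]mulrC ler_pdivrMr ?mul1r ?lerDl//.
Unshelve. all: by end_near. Qed.

(** Mean value theorem on a segment whose endpoints may lie on the boundary. The reference values
    [a] will be the derivatives at a fixed boundary point. The factor 2 arises because both
    coordinates of [v] are bounded by the maximum norm. *)
Lemma C1_segment_bound (R : realType) (om : set 'cV[R]_2) (f : 'cV[R]_2 -> R)
    (g : 'I_2 -> 'cV[R]_2 -> R) (x v : 'cV[R]_2) (a : 'I_2 -> R) (e : R) :
  open om -> C1_partials om f g -> {within closure om, continuous f} ->
  closure om x -> closure om (x + v) ->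
  (forall t, t \in `]0, 1[ -> om (x + t *: v) /\
     forall i, `|g i (x + t *: v) - a i| <= e) ->
  `|f (x + v) - f x - \sum_i a i * v i 0| <= 2 * e * `|v|.
Proof.
move=> om_open fg fc clx clxv seg.
have [||t t01 ->] := @MVT_line R _ f (fun y => \sum_i g i y * v i 0) x v.
- by move=> t t01; apply: (C1_is_derive _ om_open) => //; exact: (seg t t01).1.
- apply/subspace_continuousP => t; rewrite /= in_itv/= => /andP[t0 t1].
  (* Only the open segment is known to lie in [om]; the closed one lies in [closure om], where [f]
     is continuous. *)
  have cl s : s \in `[0, 1] -> closure om (x + s *: v).
    rewrite in_itv/= => /andP[s0 s1].
    have [->|sn0] := eqVneq s 0; first by rewrite scale0r addr0.
    have [->|sn1] := eqVneq s 1; first by rewrite scale1r.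
    apply: subset_closure; apply: (seg s _).1.
    by rewrite in_itv/= lt_neqAle eq_sym sn0 s0 lt_neqAle sn1 s1.
  have clt : closure om (x + t *: v) by apply: cl; rewrite in_itv/= t0.
  have /subspace_continuousP/(_ _ clt) := fc.
  apply: cvg_comp => P /= clP.
  have xtv : (fun s : R => x + s *: v) @ t --> x + t *: v.
    by apply: cvgD; [exact: cvg_cst | apply: cvgZr_tmp; exact: cvg_id].
  apply: (@filterS _ (nbhs t) _ _ _ _ (xtv _ clP)) => s Ps s01.
  by apply: Ps; exact: cl.
have [omt gt] := seg t t01.
rewrite !sum_ord2.
set b := g 0 _; set c := g 1 _.
have -> : b * v 0 0 + c * v 1 0 - (a 0 * v 0 0 + a 1 * v 1 0) =
  (b - a 0) * v 0 0 + (c - a 1) * v 1 0 by ring.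
rewrite (le_trans (ler_normD _ _))// !normrM -mulrA mulrDl !mul1r.
by rewrite lerD// ler_pM// ?mx_entry_le// gt.
Qed.

(** The part of a level set in [A] is open, and so is its complement in [A]; being nonempty, it is
    all of the connected set [A]. *)
Lemma connected_locally_constant (T : topologicalType) (U : Type)
    (A : set T) (f : T -> U) :
  open A -> connected A -> (forall x, A x -> \forall y \near x, f y = f x) ->
  forall x y, A x -> A y -> f x = f y.
Proof.
move=> A_open A_conn floc x y Ax Ay.
have op (P : set U) : open (A `&` f @^-1` P).
  rewrite openE => z [Az Pz]; apply: filterI; first exact: open_nbhs_nbhs.
  by apply: filterS (floc z Az) => w; rewrite /preimage/= => ->.
have : A `&` f @^-1` [set f x] = A.
  apply: A_conn; first by exists x.
  - by exists (A `&` f @^-1` [set f x]) => //; rewrite setIA setIid.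
  - exists (~` (A `&` f @^-1` (~` [set f x]))); first exact/open_closedC/op.
    apply/seteqP; split => z [Az fz]; split => //.
      by move=> [_]; apply.
    by apply: contrapT => nfz; apply: fz.
by move/seteqP => [_ /(_ _ Ay)] [].
Qed.

(** On a small ball the mean value theorem along a radius gives local constancy, and connectedness
    does the rest. *)
Lemma C1_partials0_constant (R : realType) (om : set 'cV[R]_2)
    (f : 'cV[R]_2 -> R) :
  open om -> connected om ->
  (forall x, om x -> forall i, is_derive x (delta_mx i 0) f 0) ->
  forall x y, om x -> om y -> f x = f y.
Proof.
move=> om_open om_conn f0; apply: connected_locally_constant => // x omx.
have fg : C1_partials om f (fun _ _ => 0).
  by move=> y omy i; split; [exact: f0 | exact: (@cst_continuous _ R 0)].
have xom : nbhs x om by apply: open_nbhs_nbhs; split.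
have [r /= r0 xr] := (nbhs_ballP _ _).1 xom.
apply/nbhs_ballP; exists r => //= y.
rewrite -ball_normE/= distrC => yxr.
have [t t01|t _] := @MVT_line_closed R _ f (fun=> \sum_i 0 * (y - x) i 0) x (y - x).
  apply: (C1_is_derive _ om_open fg); apply: xr.
  rewrite -ball_normE/= opprD addrA subrr add0r normrN normrZ.
  apply: le_lt_trans yxr; rewrite ler_piMl//.
  by move: t01; rewrite in_itv/= => /andP[t0 t1]; rewrite ger0_norm.
rewrite [x + _]addrC subrK big1 => [|i _]; last by rewrite mul0r.
by move/eqP; rewrite subr_eq0 => /eqP.
Qed.

(** * Symmetry of second derivatives *)

Lemma is_derive_translate (R : realType) (V : normedModType R) (f : V -> R)
    (x u v : V) (d : R) :
  is_derive (x + v) u f d -> is_derive x u (fun y => f (y + v)) d.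
Proof.
have E : (fun h => h^-1 *: (((fun y => f (y + v)) \o shift x) (h *: u)
      - f (x + v))) =
    (fun h => h^-1 *: ((f \o shift (x + v)) (h *: u) - f (x + v))).
  by apply/funext => h /=; rewrite addrA.
by move=> [df <-]; split; [rewrite /derivable E | rewrite /derive E].
Qed.

(** Mean value theorem twice: for [f (y + v) - f y] in the direction [u], then for [g] in the
    direction [v]. *)
Lemma second_difference (R : realType) (om : set 'cV[R]_2)
    (f : 'cV[R]_2 -> R) (g h : 'cV[R]_2 -> R) (x u v : 'cV[R]_2) :
  (forall s t, s \in `[0, 1] -> t \in `[0, 1] -> om (x + s *: u + t *: v)) ->
  (forall y, om y -> is_derive y u f (g y)) ->
  (forall y, om y -> is_derive y v g (h y)) ->
  exists s t, [/\ s \in `[0, 1], t \in `[0, 1] &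
    f (x + u + v) - f (x + u) - f (x + v) + f x = h (x + s *: u + t *: v)].
Proof.
move=> par fg gh.
have itv0 : (0 : R) \in `[0, 1] by rewrite in_itv/= lexx ler01.
have itv1 : (1 : R) \in `[0, 1] by rewrite in_itv/= lexx ler01.
have [s s01|s s01 E1] := @MVT_line_closed R _ (fun y => f (y + v) - f y)
    (fun y => g (y + v) - g y) x u.
  apply: is_deriveB; last first.
    by apply: fg; have := par s 0 s01 itv0; rewrite scale0r addr0.
  by apply/is_derive_translate/fg; have := par s 1 s01 itv1; rewrite scale1r.
have [t t01|t t01 E2] := @MVT_line_closed R _ g h (x + s *: u) v.
  by apply: gh; apply: par.
exists s, t; split => //; rewrite -E2 -E1; ring.
Qed.

(** The second difference is symmetric in its two directions, so the two mixed derivatives agree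
    when each is taken at a suitable point near [x]; continuity transfers this to [x] itself. *)
Lemma Schwarz (R : realType) (om : set 'cV[R]_2)
    (f : 'cV[R]_2 -> R) (g : 'I_2 -> 'cV[R]_2 -> R)
    (h : 'I_2 -> 'I_2 -> 'cV[R]_2 -> R) (i j : 'I_2) (x : 'cV[R]_2) :
  open om -> om x ->
  (forall y, om y -> forall i, is_derive y (delta_mx i 0) f (g i y)) ->
  (forall y, om y -> forall i j,
     is_derive y (delta_mx j 0) (g i) (h j i y)) ->
  (forall i j, {for x, continuous (h i j)}) ->
  h i j x = h j i x.
Proof.
move=> om_open omx fg gh hc.
apply/eqP; rewrite -subr_eq0 -normr_le0; apply/ler_addgt0Pl => e e0.
rewrite addr0.
have e20 : 0 < e / 2 by rewrite divr_gt0.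
have xom : nbhs x om by apply: open_nbhs_nbhs; split.
have xh i' j' : nbhs x [set y | `|h i' j' x - h i' j' y| <= e / 2].
  by have /cvgrPdist_le/(_ _ e20) := hc i' j'.
have [r /= r0 xr] := (nbhs_ballP _ _).1 (filterI xom (filterI (xh i j) (xh j i))).
(* Two steps of length at most [r / 4] stay inside the ball of radius [r]. *)
pose s := r / 4.
have s0 : 0 < s by rewrite divr_gt0.
have par i' j' a b : a \in `[0, 1] -> b \in `[0, 1] ->
    ball x r (x + a *: (s *: delta_mx i' 0) + b *: (s *: delta_mx j' 0)).
  rewrite !in_itv/= => /andP[a0 a1] /andP[b0 b1].
  rewrite -ball_normE/= -addrA opprD addrA subrr add0r normrN.
  have D k : `|delta_mx k 0 : 'cV[R]_2| <= 1.
    by apply: mx_norm_le => // k' l; rewrite mxE; case: (_ && _); rewrite /= ?normr1 ?normr0.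
  have N c k : 0 <= c -> c <= 1 -> `|c *: (s *: delta_mx k 0) : 'cV[R]_2| <= s.
    move=> c0 c1; rewrite normrZ (ger0_norm c0).
    rewrite normrZ (gtr0_norm s0).
    rewrite mulrCA ler_piMr// ?(ltW s0)//.
    by rewrite mulr_ile1.
  apply: (le_lt_trans (ler_normD _ _)); apply: (le_lt_trans (lerD (N _ _ a0 a1) (N _ _ b0 b1))).
  by rewrite /s; lra.
have key i' j' : exists2 y, ball x r y &
    f (x + s *: delta_mx i' 0 + s *: delta_mx j' 0) - f (x + s *: delta_mx i' 0)
      - f (x + s *: delta_mx j' 0) + f x = s * (s * h j' i' y).
  have [||| a [b [a01 b01 ->]]] := @second_difference R om f (fun y => s * g i' y)
      (fun y => s * (s * h j' i' y)) x (s *: delta_mx i' 0) (s *: delta_mx j' 0).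
  - by move=> a b a01 b01; have [] := xr _ (par i' j' _ _ a01 b01).
  - by move=> y omy; apply/is_derive_dirZ/fg.
  - move=> y omy; have := is_derive_dirZ s (gh y omy i' j').
    move=> /(@is_deriveZ _ _ _ _ s); rewrite /GRing.scale/= => H.
    by apply: is_derive_eq H _; ring.
  - by exists (x + a *: (s *: delta_mx i' 0) + b *: (s *: delta_mx j' 0)) => //; exact: par.
have [y yr Ey] := key i j; have [z zr Ez] := key j i.
have yz : h j i y = h i j z.
  apply: (mulfI (lt0r_neq0 s0)); apply: (mulfI (lt0r_neq0 s0)).
  by rewrite -Ey -Ez (addrAC x); ring.
have [_ [_ /= hy]] := xr _ yr; have [_ [/= hz _]] := xr _ zr.
rewrite (_ : _ - _ = (h i j x - h i j z) - (h j i x - h j i y)); last by rewrite yz; ring.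
by rewrite (splitr e) (le_trans (ler_normB _ _))// lerD.
Qed.

(** * Continuous extension of derivatives to the closure *)

Lemma within_closure_cvg (T U : topologicalType) (A : set T) (f : T -> U) x :
  {within closure A, continuous f} -> closure A x -> f @ within A (nbhs x) --> f x.
Proof.
move=> /subspace_continuousP fc clx; apply: cvg_trans (fc x clx).
by apply: cvg_app; apply: within_subset; exact: subset_closure.
Qed.

Lemma eq_on_closure (T U : topologicalType) (A : set T) (f g : T -> U) :
  hausdorff_space U -> {within closure A, continuous f} ->
  {within closure A, continuous g} -> (forall x, A x -> f x = g x) ->
  forall x, closure A x -> f x = g x.
Proof.
move=> hU fc gc fg x clx; have px := within_nbhs_proper clx.
apply: (@cvg_unique _ hU (f @ within A (nbhs x))).
  exact: within_closure_cvg.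
apply: cvg_trans (within_closure_cvg gc clx).
by apply: fmap_within_eq => y /set_mem; exact: fg.
Qed.

Lemma extensionE (R : realType) (V : normedModType R) (om : set 'cV[R]_2)
    (f g : 'cV[R]_2 -> V) x :
  {within closure om, continuous g} -> (forall x, om x -> g x = f x) ->
  closure om x -> extension om f x = g x.
Proof.
move=> gc gf clx; have px := within_nbhs_proper clx.
apply: cvg_lim; first exact: norm_hausdorff.
apply: cvg_trans (within_closure_cvg gc clx).
by apply: fmap_within_eq => y /set_mem omy; rewrite gf.
Qed.

(** Replaces the existential witness [g] in [Ck_closure] by the canonical [extension]. *)
Lemma Ck_closure_extension_partial (R : realType) (V : normedModType R) k
    (om : set 'cV[R]_2) (f : 'cV[R]_2 -> V) i : Ck_closure k.+1 om f ->
  {within closure om, continuous (extension om (partial i f))} /\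
  (forall x, om x -> extension om (partial i f) x = partial i f x).
Proof.
move=> [_ /(_ [:: i] isT) [_ [g [gc gf]]]].
have E x : closure om x -> extension om (partial i f) x = g x.
  exact: extensionE.
split; last by move=> x omx; rewrite E ?gf//; exact: subset_closure.
by apply: (subspace_eq_continuous _ gc) => x /set_mem clx; exact/esym/E.
Qed.

(** The extension agrees with the partial derivative on the open set [om], hence so do all their
    further derivatives there. Since [partials] applies the last index of the list first, the new
    index is appended by [rcons]. *)
Lemma Ck_closure_step (R : realType) (V : normedModType R) k
    (om : set 'cV[R]_2) (f : 'cV[R]_2 -> V) i : open om ->
  Ck_closure k.+1 om f -> Ck_closure k om (extension om (partial i f)).
Proof.
move=> om_open fk; have [ec ef] := Ck_closure_extension_partial i fk.
have E s x : om x ->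
    partials s (extension om (partial i f)) x = partials (rcons s i) f x.
  elim: s x => [|j s IH] x omx; first exact: ef.
  apply: near_eq_derive; apply: (@filterS _ (nbhs x) _ om) => //.
  by apply: open_nbhs_nbhs; split.
split => // s sk; have [|fd [g [gc gf]]] := fk.2 (rcons s i).
  by rewrite size_rcons.
split; last first.
  by exists g; split => // x omx; rewrite E// gf.
move=> sk' j x omx; have := fd _ j x omx; rewrite size_rcons => /(_ sk').
apply: near_eq_derivable; apply: (@filterS _ (nbhs x) _ om).
  by move=> y omy; rewrite E.
by apply: open_nbhs_nbhs; split.
Qed.

(** Continuity of the extension relative to [closure om] is ordinary continuity at the points of
    [om], as [om] is open. *)
Lemma C1_closure_entry (R : realType) p q (om : set 'cV[R]_2)
    (f : 'cV[R]_2 -> 'M[R]_(p, q)) a b : open om -> Ck_closure 1 om f ->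
  C1_partials om (fun x => f x a b)
    (fun i x => extension om (partial i f) x a b).
Proof.
move=> om_open f1 x omx i; have [ec ef] := Ck_closure_extension_partial i f1.
have [_ /(_ [::] isT) [/(_ isT i x omx) fd _]] := f1.
split.
  rewrite ef// /partial derive_mx// mxE; apply/derivableP.
  exact: (derivable_mxP _ _ _).1.
have omN : nbhs x om by apply: open_nbhs_nbhs; split.
apply: (@continuous_comp _ _ _ (extension om (partial i f))
  (fun M : 'M[R]_(p, q) => M a b)); last exact: coord_continuous.
have /subspace_continuousP/(_ x (subset_closure omx)) := ec.
by rewrite within_interior//; apply: filterS omN; exact: subset_closure.
Qed.

Lemma within_continuous_entry (T : topologicalType) (R : realType) p q (A : set T)
    (f : T -> 'M[R]_(p, q)) a b :
  {within A, continuous f} -> {within A, continuous (fun x => f x a b)}.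
Proof.
move=> /subspace_continuousP fc; apply/subspace_continuousP => x Ax.
apply: (cvg_comp _ (fun M : 'M[R]_(p, q) => M a b) (fc x Ax)).
exact: coord_continuous.
Qed.

(** * Cross products and rotations in dimension three *)

Lemma sum_ord3 (V : nmodType) (F : 'I_3 -> V) : \sum_i F i = F 0 + F 1 + F 2.
Proof.
by rewrite !big_ord_recl big_ord0 addr0 addrA; congr (F _ + F _ + F _); exact/val_inj.
Qed.

Lemma ord3_cases (i : 'I_3) : [\/ i = 0, i = 1 | i = 2].
Proof.
by case: i => [[|[|[|//]]] i3];
  [apply: Or31|apply: Or32|apply: Or33]; exact/val_inj.
Qed.

Lemma det_mx33 (R : comNzRingType) (M : 'M[R]_3) :
  \det M = M 0 0 * (M 1 1 * M 2 2 - M 1 2 * M 2 1)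
         - M 0 1 * (M 1 0 * M 2 2 - M 1 2 * M 2 0)
         + M 0 2 * (M 1 0 * M 2 1 - M 1 1 * M 2 0).
Proof.
have l30 : (lift 0 (0 : 'I_2) = 1 :> 'I_3) * (lift 0 (1 : 'I_2) = 2 :> 'I_3).
  by split; exact/val_inj.
have l31 : (lift 1 (0 : 'I_2) = 0 :> 'I_3) * (lift 1 (1 : 'I_2) = 2 :> 'I_3).
  by split; exact/val_inj.
have l32 : (lift 2 (0 : 'I_2) = 0 :> 'I_3) * (lift 2 (1 : 'I_2) = 1 :> 'I_3).
  by split; exact/val_inj.
have l2 : (lift 0 (0 : 'I_1) = 1 :> 'I_2) * (lift 1 (0 : 'I_1) = 0 :> 'I_2).
  by split; exact/val_inj.
rewrite (expand_det_row _ 0) sum_ord3 /cofactor.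
rewrite !(expand_det_row _ (0 : 'I_2)) !sum_ord2 /cofactor !det_mx11 !mxE.
rewrite ?(l2, l30, l31, l32) /=.
rewrite !(addn0, add0n) /= !expr0 !expr1; ring.
Qed.

Lemma crossE (R : realType) (u v : 'cV[R]_3) :
  (cross u v 0 0 = u 1 0 * v 2 0 - u 2 0 * v 1 0) *
  (cross u v 1 0 = u 2 0 * v 0 0 - u 0 0 * v 2 0) *
  (cross u v 2 0 = u 0 0 * v 1 0 - u 1 0 * v 0 0).
Proof.
have i11 : 1 + 1 = 2 :> 'I_3 by exact/val_inj.
have i12 : 1 + 2 = 0 :> 'I_3 by exact/val_inj.
have i22 : 2 + 2 = 1 :> 'I_3 by exact/val_inj.
by rewrite !mxE !add0r i11 [2 + 1]addrC i12 i22.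
Qed.

Lemma cV3_eq (R : realType) (u v : 'cV[R]_3) :
  u 0 0 = v 0 0 -> u 1 0 = v 1 0 -> u 2 0 = v 2 0 -> u = v.
Proof. by move=> ? ? ?; apply/colP => i; case: (ord3_cases i) => ->. Qed.

Lemma cV3_neq0 (R : realType) (u : 'cV[R]_3) : u != 0 ->
  [\/ u 0 0 != 0, u 1 0 != 0 | u 2 0 != 0].
Proof.
have [u0|] := eqVneq (u 0 0) 0; last by constructor 1.
have [u1|] := eqVneq (u 1 0) 0; last by constructor 2.
have [u2|] := eqVneq (u 2 0) 0; last by constructor 3.
by move=> /eqP[]; apply: cV3_eq; rewrite mxE.
Qed.

Lemma crossC (R : realType) (u v : 'cV[R]_3) : cross v u = - cross u v.
Proof. by apply: cV3_eq; rewrite [RHS]mxE !crossE; ring. Qed.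

(* Expanding the double cross product [r * (u * v)], which vanishes here. *)
Lemma orthogonal_cross_colinear (R : realType) (u v : 'cV[R]_3) (r : 'rV[R]_3) :
  cross u v != 0 -> r *m u = 0 -> r *m v = 0 ->
  exists l, forall j, r 0 j = l * cross u v j 0.
Proof.
move=> d0 /matrixP/(_ 0 0) + /matrixP/(_ 0 0); rewrite !mxE !sum_ord3 => ru rv.
set d := cross u v in d0 *.
have rd01 : r 0 0 * d 1 0 = r 0 1 * d 0 0.
  rewrite !crossE; apply/eqP; rewrite -subr_eq0; apply/eqP.
  transitivity (u 2 0 * (r 0 0 * v 0 0 + r 0 1 * v 1 0 + r 0 2 * v 2 0)
    - v 2 0 * (r 0 0 * u 0 0 + r 0 1 * u 1 0 + r 0 2 * u 2 0)); first ring.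
  by rewrite ru rv !mulr0 subr0.
have rd12 : r 0 1 * d 2 0 = r 0 2 * d 1 0.
  rewrite !crossE; apply/eqP; rewrite -subr_eq0; apply/eqP.
  transitivity (u 0 0 * (r 0 0 * v 0 0 + r 0 1 * v 1 0 + r 0 2 * v 2 0)
    - v 0 0 * (r 0 0 * u 0 0 + r 0 1 * u 1 0 + r 0 2 * u 2 0)); first ring.
  by rewrite ru rv !mulr0 subr0.
have rd20 : r 0 2 * d 0 0 = r 0 0 * d 2 0.
  rewrite !crossE; apply/eqP; rewrite -subr_eq0; apply/eqP.
  transitivity (u 1 0 * (r 0 0 * v 0 0 + r 0 1 * v 1 0 + r 0 2 * v 2 0)
    - v 1 0 * (r 0 0 * u 0 0 + r 0 1 * u 1 0 + r 0 2 * u 2 0)); first ring.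
  by rewrite ru rv !mulr0 subr0.
have [dk|dk|dk] := cV3_neq0 d0.
- exists (r 0 0 / d 0 0) => j; apply: (mulfI dk); rewrite mulrCA mulrA divfK//.
  by case: (ord3_cases j) => ->; rewrite mulrC// -?rd20 -?rd01 mulrC.
- exists (r 0 1 / d 1 0) => j; apply: (mulfI dk); rewrite mulrCA mulrA divfK//.
  by case: (ord3_cases j) => ->; rewrite mulrC// -?rd12 -?rd01 mulrC.
- exists (r 0 2 / d 2 0) => j; apply: (mulfI dk); rewrite mulrCA mulrA divfK//.
  by case: (ord3_cases j) => ->; rewrite mulrC// -?rd12 -?rd20 mulrC.
Qed.

(* [Q - 1] has rank at most one, so that [\det (1 + (Q - 1)) = 1 + \tr (Q - 1)]. *)
Lemma det1_fixed_plane_trace (R : realType) (Q : 'M[R]_3) (u v : 'cV[R]_3) :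
  \det Q = 1 -> Q *m u = u -> Q *m v = v -> cross u v != 0 -> \tr Q = 3.
Proof.
move=> detQ Qu Qv d0; set d := cross u v in d0.
have rowQ i : exists l, forall j, (Q - 1%:M) i j = l * d j 0.
  have [||l lP] := @orthogonal_cross_colinear R u v (row i (Q - 1%:M)) d0.
  - by rewrite -row_mul mulmxBl Qu mul1mx subrr row0.
  - by rewrite -row_mul mulmxBl Qv mul1mx subrr row0.
  - by exists l => j; rewrite -lP [RHS]mxE.
have [l lP] : exists l : 'I_3 -> R, forall i j, Q i j = l i * d j 0 + (i == j)%:R.
  have [l lP] := choice rowQ; exists l => i j; rewrite -lP !mxE; ring.
move: detQ; rewrite /mxtrace det_mx33 sum_ord3 !lP /= !addr0 => H.
lra.
Qed.

(** The squared Frobenius norm of [Q - 1] is [\tr ((Q - 1)^T (Q - 1)) = 2 n - 2 \tr Q], which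
    vanishes here. *)
Lemma orthogonal_trace_eq1 (R : realType) n (Q : 'M[R]_n) :
  Q^T *m Q = 1%:M -> \tr Q = n%:R -> Q = 1%:M.
Proof.
move=> QTQ trQ; pose A := Q - 1%:M.
have trA : \tr (A^T *m A) = 0.
  rewrite /A [(_ - _)^T]linearB/= trmx1 mulmxBl !mulmxBr QTQ !mulmx1 !mul1mx.
  rewrite !linearB/= mxtrace_tr trQ mxtrace1.
  by rewrite !subrr addr0.
have : \sum_i \sum_j A j i ^+ 2 = 0.
  rewrite -[RHS]trA; apply: eq_bigr => i _; rewrite mxE.
  by apply: eq_bigr => j _; rewrite [A^T _ _]mxE expr2.
move/eqP; rewrite psumr_eq0; last by move=> i _; apply: sumr_ge0 => j _; exact: sqr_ge0.
move=> /allP A0; apply/eqP; rewrite -subr_eq0; apply/eqP/matrixP => i j.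
have := A0 j (mem_index_enum _); rewrite psumr_eq0/=; last first.
  by move=> k _; exact: sqr_ge0.
by move=> /allP/(_ i (mem_index_enum _))/=; rewrite sqrf_eq0 => /eqP; rewrite !mxE.
Qed.

Lemma cross_orthogonal_neq0 (R : realType) (u v : 'cV[R]_3) :
  u != 0 -> v != 0 -> u^T *m v = 0 -> cross u v != 0.
Proof.
move=> u0 v0 /matrixP/(_ 0 0); rewrite !mxE sum_ord3 !mxE => uv.
apply/eqP => d0.
have d j : cross u v j 0 = 0 by rewrite d0 mxE.
have {d} [] := (d 0, d 1, d 2); rewrite !crossE => -[d1 d2] d3.
(* Lagrange: [|u|^2 |v|^2 = (u . v)^2 + |u * v|^2] *)
have : (u 0 0 ^+ 2 + u 1 0 ^+ 2 + u 2 0 ^+ 2) *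
       (v 0 0 ^+ 2 + v 1 0 ^+ 2 + v 2 0 ^+ 2) = 0.
  transitivity ((u 0 0 * v 0 0 + u 1 0 * v 1 0 + u 2 0 * v 2 0) ^+ 2 +
    (u 1 0 * v 2 0 - u 2 0 * v 1 0) ^+ 2 +
    (u 2 0 * v 0 0 - u 0 0 * v 2 0) ^+ 2 +
    (u 0 0 * v 1 0 - u 1 0 * v 0 0) ^+ 2); first ring.
  by rewrite uv d1 d2 d3 expr0n !addr0.
have pos (w : 'cV[R]_3) : w != 0 -> w 0 0 ^+ 2 + w 1 0 ^+ 2 + w 2 0 ^+ 2 != 0.
  move=> w0; rewrite gt_eqF//.
  have [k|k|k] := cV3_neq0 w0.
  - by rewrite -addrA ltr_pwDl ?addr_ge0 ?sqr_ge0// exprn_even_gt0.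
  - by rewrite addrAC ltr_wpDl ?addr_ge0 ?sqr_ge0// exprn_even_gt0.
  - by rewrite ltr_wpDl ?addr_ge0 ?sqr_ge0// exprn_even_gt0.
by move/eqP; rewrite mulf_eq0 (negbTE (pos _ u0)) (negbTE (pos _ v0)).
Qed.

(** [J *m v] is a combination of the two columns of [J], and their cross product is orthogonal to
    both. *)
Lemma cross_mul_orthogonal (R : realType) (J : 'M[R]_(3, 2)) (v : 'cV[R]_2) :
  (J *m v)^T *m cross (col 0 J) (col 1 J) = 0.
Proof.
apply/matrixP => i j; rewrite !ord1 mxE sum_ord3 !crossE !mxE !sum_ord2; ring.
Qed.

Lemma rank2_cross_neq0 (R : realType) (J : 'M[R]_(3, 2)) :
  \rank J = 2%N -> cross (col 0 J) (col 1 J) != 0.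
Proof.
move=> rkJ; apply/eqP => d0.
have d j : cross (col 0 J) (col 1 J) j 0 = 0 by rewrite d0 mxE.
have {d} [] := (d 0, d 1, d 2); rewrite !crossE !mxE => -[d1 d2] d3.
have Jfree : row_free J^T by rewrite /row_free mxrank_tr rkJ.
(* [J *m (J k 1, - J k 0)] consists of 2 x 2 minors of [J] *)
have J0 k : J k 0 = 0 /\ J k 1 = 0.
  pose w : 'rV[R]_2 := \row_j (if j == 0 then J k 1 else - J k 0).
  suff : w = 0.
    move=> /rowP w0; have := (w0 0, w0 1); rewrite !mxE /= => -[-> /eqP].
    by rewrite oppr_eq0 => /eqP.
  apply: (row_free_inj Jfree); rewrite mul0mx; apply/rowP => i.
  rewrite !mxE sum_ord2 !mxE /=.
  by case: (ord3_cases i) => ->; case: (ord3_cases k) => ->; lra.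
move: rkJ; have -> : J = 0; last by rewrite mxrank0.
apply/matrixP => i j; rewrite mxE.
by case: (ord2_cases j) => ->; have [] := J0 i.
Qed.

(* In terms of axial vectors: [S := Q^T *m P] and [T := Q^T *m P'] are
   antisymmetric, so that [v^T S u = v^T T v = 0], i.e. the axial vector of [S]
   is orthogonal to [cross u v]; that of [Q - Q^T] is parallel to it. *)
Lemma drilling_trace0 (R : realType) (Q P P' : 'M[R]_3) (u v : 'cV[R]_3) :
  Q^T *m Q = 1%:M -> P^T *m Q + Q^T *m P = 0 -> P'^T *m Q + Q^T *m P' = 0 ->
  P *m u = P' *m v -> cross u v != 0 -> Q *m cross u v = cross u v ->
  \tr P = 0.
Proof.
move=> QTQ QP QP' Pu d0 Qd; pose S := Q^T *m P; pose T := Q^T *m P'.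
have antisym (M N : 'M[R]_3) : M^T *m N + N^T *m M = 0 -> forall i j,
    (N^T *m M) i j = - (N^T *m M) j i.
  move=> MN i j; apply/eqP; rewrite -addr_eq0; apply/eqP.
  have := congr1 (fun X : 'M[R]_3 => X i j) MN; rewrite mxE [RHS]mxE => <-.
  rewrite addrC; congr (_ + _).
  by rewrite -[in RHS](trmxK N) -trmx_mul [RHS]mxE.
have S' := antisym _ _ QP; have T' := antisym _ _ QP'; rewrite -/S -/T in S' T'.
have vSu : v^T *m S *m u = v^T *m T *m v by rewrite -!mulmxA Pu.
have QQT : Q *m Q^T = 1%:M by exact: mulmx1C.
have -> : P = Q *m S by rewrite /S mulmxA QQT mul1mx.
clearbody S T.
have dd (M : 'M[R]_3) : (forall i j, M i j = - M j i) -> forall i, M i i = 0.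
  by move=> MM i; have := MM i i; lra.
move/matrixP/(_ 0 0) : vSu.
rewrite !mxE !sum_ord3 !mxE !sum_ord3 !mxE.
rewrite (S' 0 1) (S' 0 2) (S' 1 2) (T' 0 1) (T' 0 2) (T' 1 2).
rewrite !(dd _ S') !(dd _ T') => vSu.
have QTd : Q^T *m cross u v = cross u v.
  by rewrite -{1}Qd mulmxA QTQ mul1mx.
move: (crossE u v) d0 Qd QTd; move: (cross u v) => d dE d0 Qd QTd.
have W i : \sum_j (Q i j - Q j i) * d j 0 = 0.
  have := congr1 (fun X : 'cV[R]_3 => X i 0) (etrans Qd (esym QTd)).
  rewrite !mxE => /eqP; rewrite -subr_eq0 -sumrB => /eqP {2}<-.
  by apply: eq_bigr => j _; rewrite mxE mulrBl.
have := (W 0, W 1, W 2); rewrite !sum_ord3 /mxtrace sum_ord3 !mxE !sum_ord3.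
rewrite (S' 0 1) (S' 0 2) (S' 1 2) !(dd _ S').
have Sd : S 2 1 * d 0 0 + - S 2 0 * d 1 0 + S 1 0 * d 2 0 = 0.
  by rewrite !dE; lra.
case=> [[W0 W1] W2].
have m (a b : R) : a = 0 -> b * a = 0 by move=> ->; rewrite mulr0.
(* As [S] is antisymmetric, [\tr (Q *m S)] pairs the entries of [Q - Q^T] with those of [S].
   Multiplied by a nonzero coordinate of [d], it is a combination of [Sd] and two of the relations
   [W]. *)
have [k|k|k] := cV3_neq0 d0; apply: (mulfI k); rewrite mulr0.
- have := m _ (Q 2 1 - Q 1 2) Sd; have := m _ (S 2 0) W2.
  have := m _ (S 1 0) W1; lra.
- have := m _ (Q 0 2 - Q 2 0) Sd; have := m _ (S 2 1) W2.
  have := m _ (S 1 0) W0; lra.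
- have := m _ (Q 1 0 - Q 0 1) Sd; have := m _ (S 2 1) W1.
  have := m _ (S 2 0) W0; lra.
Qed.

(** * Paths near a Lipschitz boundary and the derivative at boundary points *)

Lemma orthogonal_entry_le1 (R : realType) n (A : 'M[R]_n) i j :
  A^T *m A = 1%:M -> `|A i j| <= 1.
Proof.
move=> /matrixP/(_ j j); rewrite !mxE eqxx (bigD1 i)//= mxE -expr2 => A1.
rewrite -(@expr_le1 _ 2)// -normrX ger0_norm ?sqr_ge0// -[leRHS]A1 lerDl.
by apply: sumr_ge0 => k _; rewrite mxE -expr2 sqr_ge0.
Qed.

Lemma orthogonal_mul_entry_le (R : realType) (A : 'M[R]_2) (w : 'cV[R]_2) i :
  A^T *m A = 1%:M -> `|(A *m w) i 0| <= `|w 0 0| + `|w 1 0|.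
Proof.
move=> AA; rewrite mxE sum_ord2 (le_trans (ler_normD _ _))// !normrM.
by rewrite lerD// ler_piMl// orthogonal_entry_le1.
Qed.

(* Two points [p], [q] of a Lipschitz graph are joined in the domain by pushing
   both down by the vector [d], of length comparable to [q - p]. *)
Lemma lipschitz_boundary_path (R : realType) (om gamma : set 'cV[R]_2)
    (p : 'cV[R]_2) :
  open om -> lipschitz_boundary om -> relatively_open (boundary om) gamma ->
  gamma p ->
  exists2 K : R, 0 < K & forall r, 0 < r -> exists q d : 'cV[R]_2,
    [/\ gamma q, q != p, `|d| <= K * `|q - p|,
        forall t, t \in `]0, 1[ -> om (p + t *: d) /\ `|p + t *: d - p| < r &
        (forall t, t \in `]0, 1[ -> om (q + t *: d) /\ `|q + t *: d - p| < r) /\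
        (forall t, t \in `[0, 1] -> om (p + d + t *: (q - p)) /\
           `|p + d + t *: (q - p) - p| < r)].
Proof.
move=> om_open om_lip [U U_open ->] [bp Up].
have [A [phi [L [AA phiL near_p]]]] := om_lip p bp.
have BB : A^T^T *m A^T = 1%:M by rewrite trmxK; exact: mulmx1C.
have pU : nbhs p U by apply: open_nbhs_nbhs; split.
have [r0 /= r00 pr0] := (nbhs_ballP _ _).1 (filterI near_p pU).
(* A Lipschitz constant that is at least 1, whatever the sign of [L]. *)
pose K0 : R := `|L| + 1.
have K01 : 1 <= K0 by rewrite lerDr.
have K0gt : 0 < K0 by exact: lt_le_trans K01.
have phiK s t : `|phi s - phi t| <= K0 * `|s - t|.
  apply: (le_trans (phiL s t)); rewrite ler_wpM2r//.
  by rewrite (le_trans (ler_norm L))// lerDl.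
pose V (s t : R) : 'cV[R]_2 := \col_i (if i == 0 then s else t).
(* The point whose coordinates after the orthogonal change [A] are [(s, t)]. *)
pose X s t := A^T *m V s t.
have AX s t : ((A *m X s t) 0 0 = s) * ((A *m X s t) 1 0 = t).
  by rewrite /X mulmxA -{1 3}(trmxK A) BB mul1mx !mxE.
have normX s t : `|X s t| <= `|s| + `|t|.
  apply: mx_norm_le => [|i j]; first by rewrite addr_ge0.
  rewrite (ord1 j); apply: le_trans (orthogonal_mul_entry_le _ _ BB) _.
  by rewrite !mxE.
have XD s t s' t' : X s t + X s' t' = X (s + s') (t + t').
  rewrite /X -mulmxDr; congr (_ *m _); apply/colP => i; rewrite !mxE.
  by case: ifP.
have XZ a s t : a *: X s t = X (a * s) (a * t).
  rewrite /X scalemxAr; congr (_ *m _); apply/colP => i; rewrite !mxE.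
  by case: ifP.
have XN s t : - X s t = X (- s) (- t) by rewrite -scaleN1r XZ !mulN1r.
have normA (w : 'cV[R]_2) i : `|(A *m w) i 0| <= 2 * `|w|.
  apply: le_trans (orthogonal_mul_entry_le _ _ AA) _.
  by rewrite mulrDl mul1r lerD// mx_entry_le.
have omX s t : `|X s t - p| < r0 -> om (X s t) <-> t < phi s.
  rewrite distrC => Xp; have [] := pr0 (X s t); first by rewrite -ball_normE.
  by rewrite /= !AX.
have omN q : boundary om q -> ~ om q.
  by move=> [_ nq] omq; apply: nq; apply: open_nbhs_nbhs; split.
pose s0 := (A *m p) 0 0; pose t0 := (A *m p) 1 0.
have pE : p = X s0 t0.
  rewrite /X -[LHS]mul1mx -AA -mulmxA; congr (_ *m _); apply/colP => i.
  by rewrite [RHS]mxE; case: (ord2_cases i) => ->.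
(* [p] lies on the graph: not below it, since [p] is not in the open set [om], and not above it,
   since points of [om] approximate [p]. *)
have t0E : t0 = phi s0.
  apply/eqP; rewrite eq_le; apply/andP; split; last first.
    rewrite leNgt; apply/negP => t0phi; apply: (omN _ bp).
    by rewrite pE; apply/omX => //; rewrite -pE subrr normr0.
  apply/ler_addgt0Pl => e e0.
  (* Each rotated coordinate of [p - y] is at most [2 * |p - y|], and [phi] multiplies the first one
     by at most [K0]. *)
  pose e1 := Num.min r0 (e / (2 + 2 * K0)).
  have den : 0 < 2 + 2 * K0 by rewrite addr_gt0// mulr_gt0.
  have e10 : 0 < e1 by rewrite lt_min r00 divr_gt0.
  have [y [omy py]] := bp.1 _ (nbhsx_ballx p _ e10).
  move: py; rewrite -ball_normE/= => py.
  have [|+ _] := pr0 y; first by rewrite -ball_normE/= (lt_le_trans py)// ge_min lexx.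
  move=> /iffLR/(_ omy) yphi.
  have d0 := normA (p - y) 0; have d1 := normA (p - y) 1.
  have pyE k : (A *m (p - y)) k 0 = (A *m p) k 0 - (A *m y) k 0.
    by rewrite mulmxBr !mxE.
  rewrite !pyE -/s0 -/t0 in d0 d1.
  have := phiK ((A *m y) 0 0) s0; rewrite [`|_ - s0|]distrC => dphi.
  have e1e : (2 + 2 * K0) * `|p - y| <= e.
    rewrite -ler_pdivlMl// (le_trans (ltW py))// ge_min [_^-1 * _]mulrC lexx orbT//.
  have dphi' : K0 * `|s0 - (A *m y) 0 0| <= K0 * (2 * `|p - y|).
    by rewrite ler_wpM2l// ltW.
  have := ler_norm (phi ((A *m y) 0 0) - phi s0).
  have := ler_norm (t0 - (A *m y) 1 0).
  by lra.
(* The push [d] will have length at most [h = 3 * (K0 * delta)], and [delta] is at most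
   [2 * |q - p|]. *)
exists (6 * K0) => [|r rgt0]; first by rewrite mulr_gt0.
pose rho := Num.min r r0.
have rho0 : 0 < rho by rewrite lt_min rgt0.
(* All points used lie within [delta + 4 * (K0 * delta)] of [p], which is at most [5 / 8] of
   [rho]. *)
pose delta := rho / (8 * K0).
have delta0 : 0 < delta by rewrite divr_gt0// mulr_gt0.
have K0delta : 8 * (K0 * delta) = rho.
  by rewrite /delta mulrA mulrC divfK// gt_eqF// mulr_gt0.
have delta_le : delta <= K0 * delta by rewrite ler_peMl// ltW.
(* Between [s0] and [s0 + delta] the graph varies by at most [K0 * delta] from its height at [p].
   After a push by three times this amount, the chord from [p + d] to [q + d] lies at depth between
   [2 * (K0 * delta)] and [4 * (K0 * delta)] below [p], hence strictly below the graph. *)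
pose h := 3 * (K0 * delta).
pose q := X (s0 + delta) (phi (s0 + delta)); pose d := X 0 (- h).
have dphi s : 0 <= s -> s <= delta ->
    phi s0 - K0 * delta <= phi (s0 + s) <= phi s0 + K0 * delta.
  move=> s_ge0 s_le; rewrite -ler_distl (le_trans (phiK _ _))//.
  by rewrite addrC addKr ler_wpM2l ?ger0_norm// ltW.
have in_rho s t : 0 <= s -> s <= delta -> `|t - phi s0| <= 4 * (K0 * delta) ->
    `|X (s0 + s) t - p| < rho.
  move=> s_ge0 s_le t_le; rewrite [X in _ - X]pE t0E XN XD.
  apply: le_lt_trans (normX _ _) _; rewrite addrAC subrr add0r ger0_norm//.
  lra.
have rho_r (y : 'cV[R]_2) : `|y| < rho -> `|y| < r by rewrite lt_min => /andP[].
have rho_r0 (y : 'cV[R]_2) : `|y| < rho -> `|y| < r0 by rewrite lt_min => /andP[].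
have inside s t : 0 <= s -> s <= delta -> phi s0 - 4 * (K0 * delta) <= t ->
    t < phi (s0 + s) -> om (X (s0 + s) t) /\ `|X (s0 + s) t - p| < r.
  move=> s_ge0 s_le t_ge t_lt; have /andP[_ phi_le] := dphi s s_ge0 s_le.
  have Xrho : `|X (s0 + s) t - p| < rho.
    by apply: in_rho => //; rewrite ler_norml; apply/andP; split; lra.
  by split; [apply/omX => //; exact: rho_r0 | exact: rho_r].
have K0d0 : 0 < K0 * delta by rewrite mulr_gt0.
have h0 : 0 < h by rewrite mulr_gt0.
have qd t : 0 < t -> t <= 1 -> om (q + t *: d) /\ `|q + t *: d - p| < r.
  move=> t_gt0 t_le1; rewrite /q /d XZ mulr0 XD addr0.
  have th0 : 0 < t * h by exact: mulr_gt0.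
  have thh : t * h <= h by exact: ler_piMl (ltW h0) t_le1.
  have /andP[phi_ge _] := dphi delta (ltW delta0) (lexx _).
  by apply: inside => //; [exact: ltW | rewrite /h in thh *; lra | lra].
have qrho : `|q - p| < rho.
  have /andP[phi_ge phi_le] := dphi delta (ltW delta0) (lexx _).
  by apply: in_rho => //; [exact: ltW | rewrite ler_norml; apply/andP; split; lra].
have norm_d : `|d| <= h.
  by rewrite (le_trans (normX _ _))// normr0 add0r normrN gtr0_norm.
(* The points [q + t *: d] with small positive [t] lie in [om] and approach [q], while [q] itself is
   on the graph and so outside [om]. *)
have bq : boundary om q.
  split; last first.
    by move=> /interior_subset /(omX _ _ (rho_r0 _ qrho)); rewrite ltxx.
  move=> B /nbhs_ballP[e /= e0 eB].
  pose t := Num.min 1 (e / (2 * h)).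
  have t_gt0 : 0 < t by rewrite lt_min ltr01 divr_gt0// mulr_gt0.
  have t_le1 : t <= 1 by rewrite ge_min lexx.
  exists (q + t *: d); split; first by have [] := qd t t_gt0 t_le1.
  apply: eB; rewrite -ball_normE/= opprD addrA subrr add0r normrN normrZ gtr0_norm//.
  have te : t * (2 * h) <= e.
    have h20 : 0 < 2 * h by exact: mulr_gt0.
    by rewrite -(ler_pdivlMr _ _ h20) ge_min lexx orbT.
  have : t * `|d| <= t * h by exact: ler_wpM2l (ltW t_gt0) _ _ norm_d.
  have : 0 < t * h by exact: mulr_gt0.
  lra.
(* [delta] is the first rotated coordinate of [q - p]. *)
have delta_pq : delta <= 2 * `|q - p|.
  have := normA (q - p) 0.
  rewrite mulmxBr [X in `|X|]mxE AX [X in _ + X]mxE -/s0.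
  by rewrite [s0 + _]addrC addrK gtr0_norm.
exists q, d; split => //.
- split => //; have [|_] := pr0 q => //.
  by rewrite -ball_normE/= distrC rho_r0.
- apply/eqP => qp; move: delta_pq; rewrite qp subrr normr0 mulr0.
  by rewrite leNgt delta0.
- apply: (le_trans norm_d); rewrite /h.
  have := ler_wpM2l (ltW K0gt) delta_pq; lra.
- move=> t; rewrite in_itv/= => /andP[t_gt0 /ltW t_le1].
  rewrite [X in om (X + _)]pE [X in `|X + _ - _|]pE /d XZ mulr0 XD t0E.
  have th0 : 0 < t * h by exact: mulr_gt0.
  have thh : t * h <= h by exact: ler_piMl (ltW h0) t_le1.
  by apply: inside => //; [exact: ltW | rewrite /h in thh *; lra | rewrite addr0; lra].
- split.
    by move=> t; rewrite in_itv/= => /andP[t_gt0 /ltW]; exact: qd.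
  move=> t; rewrite in_itv/= => /andP[t_ge0 t_le1].
  have E : p + d + t *: (q - p) =
      X (s0 + t * delta) (phi s0 - h + t * (phi (s0 + delta) - phi s0)).
    rewrite /q /d pE t0E XN !XD XZ XD; congr (X _ _); ring.
  rewrite E.
  have td0 : 0 <= t * delta by rewrite mulr_ge0// ltW.
  have tdd : t * delta <= delta by rewrite ler_piMl// ltW.
  have := phiK (s0 + t * delta) s0; have := phiK (s0 + delta) s0.
  rewrite ![_ + _ - s0]addrC !addKr (gtr0_norm delta0) (ger0_norm td0).
  rewrite !ler_distl => /andP[ph1 ph2] /andP[ph3 ph4].
  have tphi : `|t * (phi (s0 + delta) - phi s0)| <= K0 * (t * delta).
    rewrite normrM ger0_norm// mulrCA ler_wpM2l// ler_distl; apply/andP; split; lra.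
  have Ktd : K0 * (t * delta) <= K0 * delta by rewrite ler_wpM2l// ltW.
  move: tphi; rewrite ler_norml => /andP[tp1 tp2].
  by apply: inside => //; rewrite /h; lra.
Qed.

(** Add the segment bounds along [p], [p + d], [q + d], [q]: the first and last segments are
    traversed in opposite directions, so the linear terms in [d] cancel. *)
Lemma C1_path_estimate (R : realType) (om : set 'cV[R]_2) (f : 'cV[R]_2 -> R)
    (g : 'I_2 -> 'cV[R]_2 -> R) (p q d : 'cV[R]_2) (a : 'I_2 -> R) (e r : R) :
  open om -> C1_partials om f g -> {within closure om, continuous f} ->
  closure om p -> closure om q ->
  (forall y, om y -> `|y - p| < r -> forall i, `|g i y - a i| <= e) ->
  (forall t, t \in `]0, 1[ -> om (p + t *: d) /\ `|p + t *: d - p| < r) ->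
  (forall t, t \in `]0, 1[ -> om (q + t *: d) /\ `|q + t *: d - p| < r) ->
  (forall t, t \in `[0, 1] -> om (p + d + t *: (q - p)) /\
     `|p + d + t *: (q - p) - p| < r) ->
  `|f q - f p - \sum_i a i * (q - p) i 0| <= 2 * e * (2 * `|d| + `|q - p|).
Proof.
move=> om_open fg fc clp clq gr segp segq segpq.
have qdE : q + d = p + d + (q - p) by rewrite [p + d]addrC -addrA [p + _]addrC subrK addrC.
have clpd : closure om (p + d).
  have [|+ _] := segpq 0; first by rewrite in_itv/= lexx ler01.
  by rewrite scale0r addr0; exact: subset_closure.
have clqd : closure om (q + d).
  have [|+ _] := segpq 1; first by rewrite in_itv/= lexx ler01.
  by rewrite scale1r -qdE; exact: subset_closure.
have Hp := @C1_segment_bound R om f g p d a e om_open fg fc clp clpd.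
have Hq := @C1_segment_bound R om f g q d a e om_open fg fc clq clqd.
have Hpq := @C1_segment_bound R om f g (p + d) (q - p) a e om_open fg fc clpd.
rewrite -qdE in Hpq.
have {}Hp := Hp (fun t t01 => conj (segp t t01).1 (gr _ (segp t t01).1 (segp t t01).2)).
have {}Hq := Hq (fun t t01 => conj (segq t t01).1 (gr _ (segq t t01).1 (segq t t01).2)).
have {}Hpq : `|f (q + d) - f (p + d) - \sum_i a i * (q - p) i 0| <= 2 * e * `|q - p|.
  apply: Hpq => // t t01; have [|omt rt] := segpq t; first exact: subset_itv_oo_cc.
  by split => //; exact: gr.
move: Hp Hq Hpq; set Sd := \sum_i a i * d i 0; set Sw := \sum_i a i * (q - p) i 0.
rewrite !ler_norml => /andP[? ?] /andP[? ?] /andP[? ?].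
apply/andP; split; lra.
Qed.

(** If the Jacobi matrix were injective, a left inverse would bound [|q - p|] by a multiple of its
    image. But for [q] in [gamma] near [p] the path estimate makes that image an arbitrarily small
    multiple of [|q - p|], because [f] vanishes at both ends. *)
Lemma boundary_jacobian_kernel (R : realType) n (om gamma : set 'cV[R]_2)
    (f : 'I_n -> 'cV[R]_2 -> R) (g : 'I_n -> 'I_2 -> 'cV[R]_2 -> R)
    (p : 'cV[R]_2) :
  open om -> lipschitz_boundary om -> relatively_open (boundary om) gamma ->
  gamma p -> (forall k, C1_partials om (f k) (g k)) ->
  (forall k, {within closure om, continuous (f k)}) ->
  (forall k i, {within closure om, continuous (g k i)}) ->
  (forall k x, gamma x -> f k x = 0) ->
  exists2 v : 'cV[R]_2, v != 0 & (\matrix_(k < n, i < 2) g k i p) *m v = 0.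
Proof.
move=> om_open om_lip gam_open gamp fg fc gc f0; set F := \matrix_(_, _) _.
have gam_cl x : gamma x -> closure om x.
  by case: gam_open => U _ -> [[]].
have [Ffree|] := boolP (row_free F^T); last first.
  rewrite -kermx_eq0 => /rowV0Pn[v /sub_kermxP vF v0].
  exists v^T; first by rewrite -[0]trmx0 (inj_eq (can_inj (@trmxK _ _ _))).
  by rewrite -[F]trmxK -trmx_mul vF trmx0.
have [B FB] := row_freeP Ffree.
have [K K0 path] := lipschitz_boundary_path om_open om_lip gam_open gamp.
pose c := n%:R * `|B|; have c0 : 0 <= c by rewrite mulr_ge0.
(* Chosen so that the final estimate reads [|q - p| <= c / (c + 1) * |q - p|], with a factor below
   1. *)
pose e := ((2 * K + 1) * (2 * (c + 1)))^-1.
have e0 : 0 < e.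
  by rewrite invr_gt0 !mulr_gt0// ltr_wpDl// mulr_ge0// ltW.
have near_p : nbhs p [set y | forall k i, closure om y -> `|g k i p - g k i y| <= e].
  apply: (@filter_forall _ _ (fun k y => forall i, closure om y ->
    `|g k i p - g k i y| <= e) (nbhs p) _) => k.
  apply: (@filter_forall _ _ (fun i y => closure om y ->
    `|g k i p - g k i y| <= e) (nbhs p) _) => i.
  have /subspace_continuousP/(_ p (gam_cl _ gamp)) := gc k i.
  by move=> /cvgrPdist_le/(_ _ e0).
have [r /= r0 pr] := (nbhs_ballP _ _).1 near_p.
have [q [d [gamq qp dK segp [segq segpq]]]] := path r r0.
have w0 : 0 < `|q - p| by rewrite normr_gt0 subr_eq0.
have est k : `|(F *m (q - p)) k 0| <= 2 * e * (2 * `|d| + `|q - p|).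
  have := @C1_path_estimate R om (f k) (g k) p q d (fun i => g k i p) e r
    om_open (fg k) (fc k) (gam_cl _ gamp) (gam_cl _ gamq).
  rewrite !f0// subrr sub0r normrN => H; rewrite mxE.
  under eq_bigr do rewrite mxE.
  apply: H => // y omy yr i; rewrite distrC; apply: pr; last exact: subset_closure.
  by rewrite -ball_normE/= distrC.
(* [B^T] is a left inverse of [F]. *)
have wE : q - p = B^T *m (F *m (q - p)).
  by rewrite mulmxA -[F in B^T *m F]trmxK -trmx_mul FB trmx1 mul1mx.
have : `|q - p| <= c * (2 * e * (2 * `|d| + `|q - p|)).
  have rhs0 : 0 <= 2 * e * (2 * `|d| + `|q - p|).
    by rewrite !mulr_ge0// ?addr_ge0// ?mulr_ge0// ltW.
  rewrite {1}wE; apply: mx_norm_le => [|i j]; first by rewrite mulr_ge0.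
  rewrite mxE (ord1 j) (le_trans (ler_norm_sum _ _ _))//.
  rewrite [leRHS](_ : _ = \sum_(k < n) `|B| * (2 * e * (2 * `|d| + `|q - p|))).
    apply: ler_sum => k _; rewrite normrM ler_pM//.
    by rewrite mxE mx_entry_le.
  by rewrite sumr_const card_ord /c -mulrA mulr_natl.
have dK' : 2 * `|d| + `|q - p| <= (2 * K + 1) * `|q - p|.
  by rewrite [leRHS]mulrDl mul1r lerD2r -mulrA ler_wpM2l.
have : c * (2 * e * (2 * `|d| + `|q - p|)) <= c * (2 * e * ((2 * K + 1) * `|q - p|)).
  by rewrite ler_wpM2l// ler_wpM2l// mulr_ge0// ltW.
have -> : c * (2 * e * ((2 * K + 1) * `|q - p|)) = c / (c + 1) * `|q - p|.
  rewrite /e; field; apply/andP; split; rewrite gt_eqF//.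
    by rewrite ltr_wpDl.
  by rewrite ltr_wpDl// mulr_ge0// ltW.
move=> h1 h2; have := le_trans h2 h1; rewrite leNgt => /negP[].
by rewrite gtr_pMl// ltr_pdivrMr ?mul1r ?ltrDl// ltr_wpDl.
Qed.

(** * Differentiating the orthogonality of [Q] and the relation between the Jacobi matrices *)

Lemma is_derive_unique (R : realType) (V W : normedModType R) (f g : V -> W)
    (x v : V) (a b : W) :
  is_derive x v f a -> is_derive x v g b -> (\near x, f x = g x) -> a = b.
Proof. by move=> [_ <-] [_ <-] fg; exact: near_eq_derive. Qed.

Lemma is_derive_mulmx_entry (R : realType) (V : normedModType R) m n p
    (A : V -> 'M[R]_(m, n)) (B : V -> 'M[R]_(n, p)) (A' : 'M[R]_(m, n))
    (B' : 'M[R]_(n, p)) (x v : V) i j :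
  (forall i j, is_derive x v (fun y => A y i j) (A' i j)) ->
  (forall i j, is_derive x v (fun y => B y i j) (B' i j)) ->
  is_derive x v (fun y => (A y *m B y) i j) ((A' *m B x + A x *m B') i j).
Proof.
move=> dA dB.
have -> : (fun y => (A y *m B y) i j) =
    \sum_(k < n) (fun y => A y i k * B y k j).
  by apply/funext => y; rewrite mxE fct_sumE.
have d k : is_derive x v (fun y => A y i k * B y k j)
    (A' i k * B x k j + A x i k * B' k j).
  apply: is_derive_eq (is_deriveM (dA i k) (dB k j)) _.
  rewrite /GRing.scale/=; ring.
apply: is_derive_eq (is_derive_sum d) _.
by rewrite !mxE -big_split.
Qed.

Lemma euclidean_norm_neq0 (R : realType) (u : 'cV[R]_3) :
  u != 0 -> euclidean_norm u != 0.
Proof.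
move=> u0; have S0 : 0 <= \sum_i u i 0 ^+ 2 by apply: sumr_ge0 => i _; exact: sqr_ge0.
rewrite /euclidean_norm sqrtr_eq0 -ltNge lt_def S0 andbT.
apply: contraNneq u0 => /eqP; rewrite psumr_eq0 => [/allP u0|i _]; last exact: sqr_ge0.
apply/eqP/colP => i; rewrite mxE; apply/eqP.
by have := u0 i (mem_index_enum _); rewrite /= sqrf_eq0.
Qed.

Lemma jacobi_entry (R : realType) (om : set 'cV[R]_2) (f : 'cV[R]_2 -> 'cV[R]_3)
    x k j : jacobi om f x k j = extension om (partial j f) x k 0.
Proof. by rewrite mxE. Qed.

Lemma jacobi_symmetric (R : realType) (om : set 'cV[R]_2)
    (f : 'cV[R]_2 -> 'cV[R]_3) x i j k : open om -> om x -> Ck_closure 2 om f ->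
  extension om (partial i (extension om (partial j f))) x k 0 =
  extension om (partial j (extension om (partial i f))) x k 0.
Proof.
move=> om_open omx f2.
have f1 : Ck_closure 1 om f.
  split; [exact: f2.1 | move=> s s1].
  have [fd fg] := f2.2 s (leq_trans s1 (leqnSn _)).
  by split => // s_lt; apply: fd; exact: leq_trans s_lt _.
apply: (@Schwarz R om (fun y => f y k 0)
  (fun i y => extension om (partial i f) y k 0)
  (fun i j y => extension om (partial i (extension om (partial j f))) y k 0)) => //.
- by move=> y omy i'; exact: (C1_closure_entry _ _ om_open f1 omy i').1.
- move=> y omy i' j'.
  exact: (C1_closure_entry _ _ om_open (Ck_closure_step i' om_open f2) omy j').1.
- move=> i' j'.
  exact: (C1_closure_entry _ _ om_open (Ck_closure_step j' om_open f2) omx i').2.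
Qed.

(** Product rule for [Q^T *m Q], which is constant near [x]. *)
Lemma rotation_derivative_antisym (R : realType) (om : set 'cV[R]_2)
    (Q : 'cV[R]_2 -> 'M[R]_3) (P : 'M[R]_3) (x v : 'cV[R]_2) :
  open om -> om x -> (forall y, om y -> (Q y)^T *m Q y = 1%:M) ->
  (forall a b, is_derive x v (fun y => Q y a b) (P a b)) ->
  P^T *m Q x + (Q x)^T *m P = 0.
Proof.
move=> om_open omx QQ dQ; apply/matrixP => a b; rewrite [RHS]mxE.
have omN : nbhs x om by apply: open_nbhs_nbhs; split.
apply: (@is_derive_unique R _ _ (fun y => ((Q y)^T *m Q y) a b)
  (cst ((1%:M : 'M[R]_3) a b)) x v).
- apply: (@is_derive_mulmx_entry R _ 3 3 3 (fun y => (Q y)^T) Q P^T P) => // i j.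
  rewrite mxE; under eq_fun do rewrite mxE; exact: dQ.
- by apply: filterS omN => y /QQ ->.
Qed.

(** Differentiate the [j]-th column of [Dm = Q Dy0] in the direction [i], and conversely. The second
    derivatives of [m] and of [y0] are symmetric, so the terms in which [Q] multiplies second
    derivatives of [y0] cancel. *)
Lemma drilling_compatibility (R : realType) (om : set 'cV[R]_2)
    (m y0 : 'cV[R]_2 -> 'cV[R]_3) (Q : 'cV[R]_2 -> 'M[R]_3) x i j :
  open om -> om x -> Ck_closure 2 om m -> Ck_closure 2 om y0 ->
  Ck_closure 1 om Q ->
  (forall x, om x -> jacobi om m x = Q x *m jacobi om y0 x) ->
  extension om (partial i Q) x *m col j (jacobi om y0 x) =
  extension om (partial j Q) x *m col i (jacobi om y0 x).
Proof.
move=> om_open omx m2 y2 Q1 Dm_eq.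
have omN : nbhs x om by apply: open_nbhs_nbhs; split.
have key i' j' a :
    extension om (partial i' (extension om (partial j' m))) x a 0 =
    (extension om (partial i' Q) x *m col j' (jacobi om y0 x) +
     Q x *m extension om (partial i' (extension om (partial j' y0))) x) a 0.
  have colE y : col j' (jacobi om y0 y) = extension om (partial j' y0) y.
    by apply/colP => k; rewrite !mxE.
  rewrite colE.
  apply: (@is_derive_unique R _ _ (fun y => extension om (partial j' m) y a 0)
    (fun y => (Q y *m extension om (partial j' y0) y) a 0) x (delta_mx i' 0)).
  - exact: (C1_closure_entry _ _ om_open (Ck_closure_step j' om_open m2) omx i').1.
  - apply: is_derive_mulmx_entry => a' b'.
      exact: (C1_closure_entry _ _ om_open Q1 omx i').1.
    exact: (C1_closure_entry _ _ om_open (Ck_closure_step j' om_open y2) omx i').1.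
  - apply: filterS omN => y omy.
    rewrite -jacobi_entry Dm_eq// -colE [LHS]mxE [RHS]mxE.
    by apply: eq_bigr => k _; rewrite [col _ _ _ _]mxE.
apply/colP => a.
have E : extension om (partial i (extension om (partial j y0))) x =
    extension om (partial j (extension om (partial i y0))) x.
  by apply/colP => b; exact: jacobi_symmetric.
have cancel (A B Y Y' : 'cV[R]_3) :
    Y = Y' -> (A + Y) a 0 = (B + Y') a 0 -> A a 0 = B a 0.
  by move=> ->; rewrite mxE [RHS]mxE; exact: addIr.
exact: (cancel _ _ _ _ (congr1 (mulmx (Q x)) E) (etrans (esym (key i j a))
  (etrans (jacobi_symmetric i j a om_open omx m2) (key j i a)))).
Qed.

Lemma partial_trace0 (R : realType) (om : set 'cV[R]_2)
    (m y0 : 'cV[R]_2 -> 'cV[R]_3) (Q : 'cV[R]_2 -> 'M[R]_3) x i :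
  open om -> om x -> Ck_closure 2 om m -> Ck_closure 2 om y0 ->
  Ck_closure 1 om Q ->
  (forall x, om x -> (Q x)^T *m Q x = 1%:M) ->
  (forall x, om x -> jacobi om m x = Q x *m jacobi om y0 x) ->
  \rank (jacobi om y0 x) = 2%N ->
  (let c := cross (col 0 (jacobi om y0 x)) (col 1 (jacobi om y0 x)) in
   Q x *m c = c) ->
  \tr (extension om (partial i Q) x) = 0.
Proof.
move=> om_open omx m2 y2 Q1 QQ Dm_eq rk2 /= Qc.
have c0 := rank2_cross_neq0 rk2.
have antisym j := rotation_derivative_antisym om_open omx QQ
  (fun a b => (C1_closure_entry a b om_open Q1 omx j).1).
case: (ord2_cases i) => ->.
(* Compatibility pairs the derivative of [Q] in one direction with the tangent vector of the other;
   for [i = 0] the columns are therefore swapped and the normal changes sign. *)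
- apply: (drilling_trace0 (QQ _ omx) (antisym 0) (antisym 1) _ _
    (u := col 1 (jacobi om y0 x)) (v := col 0 (jacobi om y0 x))).
  + exact: drilling_compatibility m2 y2 Q1 Dm_eq.
  + by rewrite crossC oppr_eq0.
  + by rewrite crossC mulmxN Qc.
- apply: (drilling_trace0 (QQ _ omx) (antisym 1) (antisym 0) _ c0 Qc).
  exact: drilling_compatibility m2 y2 Q1 Dm_eq.
Qed.

Theorem proposition1p1 (R : realType) (om gamma : set 'cV[R]_2)
    (m y0 : 'cV[R]_2 -> 'cV[R]_3) (Q : 'cV[R]_2 -> 'M[R]_3)
    (om_domain : bounded_lipschitz_domain om)
    (gamma_open : relatively_open (boundary om) gamma)
    (gamma_neq0 : gamma !=set0)
    (m_C2 : Ck_closure 2 om m) (m_regular : regular_surface om m)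
    (y0_C2 : Ck_closure 2 om y0) (y0_regular : regular_surface om y0)
    (Q_C1 : Ck_closure 1 om Q)
    (Q_SO3 : forall x, closure om x -> SO3 (Q x))
    (Dm_eq : forall x, closure om x -> jacobi om m x = Q x *m jacobi om y0 x)
    (Qn0_eq : forall x, closure om x ->
       Q x *m unit_normal om y0 x = unit_normal om y0 x)
    (m_eq_gamma : forall x, gamma x -> m x = y0 x) :
  forall x, closure om x -> m x = y0 x.
Proof.
have [om_open om_conn _ om_lip] := om_domain.
have om_cl := @subset_closure _ om.
have [p gamp] := gamma_neq0.
have gam_cl x : gamma x -> closure om x by case: gamma_open => U _ -> [[]].
have clp := gam_cl p gamp.
have [[m_C1 _] [y0_C1 y0_rank]] := (m_regular, y0_regular).
pose c x := cross (col 0 (jacobi om y0 x)) (col 1 (jacobi om y0 x)).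
have Qc x : closure om x -> Q x *m c x = c x.
  (* The normalising factor is nonzero because [Dy0] has rank 2, so it can be cancelled. *)
  move=> clx; have := Qn0_eq x clx; rewrite /unit_normal -/(c x) -scalemxAr.
  apply: scalerI; rewrite invr_eq0.
  exact/euclidean_norm_neq0/rank2_cross_neq0/y0_rank.
have trQ_const x y : om x -> om y -> \tr (Q x) = \tr (Q y).
  apply: (@C1_partials0_constant R om (fun x => \tr (Q x))) => // z omz i.
  have tr0 : \tr (extension om (partial i Q) z) = 0.
    apply: (partial_trace0 i om_open omz m_C2 y0_C2 Q_C1).
    - by move=> w /om_cl/Q_SO3[].
    - by move=> w /om_cl; exact: Dm_eq.
    - exact/y0_rank/om_cl.
    - exact/Qc/om_cl.
  rewrite /mxtrace.
  have -> : (fun x => \sum_k Q x k k) = \sum_(k < 3) (fun x => Q x k k).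
    by apply/funext => w; rewrite fct_sumE.
  exact: is_derive_eq (is_derive_sum (fun k =>
    (C1_closure_entry k k om_open Q_C1 omz i).1)) tr0.
have trQ_cont : {within closure om, continuous (fun x => \tr (Q x))}.
  apply/subspace_continuousP => x clx.
  have Qkk k : (fun y => Q y k k) @ within (closure om) (nbhs x) --> Q x k k.
    have /subspace_continuousP := within_continuous_entry (a := k) (b := k) Q_C1.1.
    exact.
  have trE : (fun y => \tr (Q y)) = fun y => Q y 0 0 + Q y 1 1 + Q y 2 2.
    by apply/funext => y; exact: sum_ord3.
  rewrite trE.
  by apply: cvgD; [apply: cvgD|]; exact: Qkk.
have mk k := within_continuous_entry (a := k) (b := 0) m_C1.1.
have yk k := within_continuous_entry (a := k) (b := 0) y0_C1.1.
have myk k : {within closure om, continuous (fun x => m x k 0 - y0 x k 0)}.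
  by move=> x; apply: continuousB; [exact: mk | exact: yk].
have trQp : \tr (Q p) = 3.
  have [||||v v0 Fv] := @boundary_jacobian_kernel R 3 om gamma
    (fun k x => m x k 0 - y0 x k 0)
    (fun k i x => extension om (partial i m) x k 0 -
      extension om (partial i y0) x k 0) p om_open om_lip
    gamma_open gamp.
  - move=> k x omx i.
    have [dm cm] := C1_closure_entry k 0 om_open m_C1 omx i.
    have [dy cy] := C1_closure_entry k 0 om_open y0_C1 omx i.
    split; first by have := is_deriveB dm dy.
    by have := continuousB cm cy.
  - exact: myk.
  - move=> k i x.
    have [em _] := Ck_closure_extension_partial i m_C1.
    have [ey _] := Ck_closure_extension_partial i y0_C1.
    have emk := within_continuous_entry (a := k) (b := 0) em.
    have eyk := within_continuous_entry (a := k) (b := 0) ey.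
    by apply: continuousB; [exact: emk | exact: eyk].
  - by move=> k x gamx; rewrite m_eq_gamma// subrr.
  set F := \matrix_(_, _) _ in Fv.
  (* At [p] the Jacobi matrix of [m - y0] is [(Q - 1) Dy0], so its kernel vector [v] yields a
     tangent vector fixed by [Q p]. *)
  have {}Fv : Q p *m (jacobi om y0 p *m v) = jacobi om y0 p *m v.
    apply/eqP; rewrite -subr_eq0 mulmxA -Dm_eq// -mulmxBl -[X in _ == X]Fv.
    apply/eqP; congr (_ *m _); apply/matrixP => k i; rewrite !mxE//.
  have [_ detQ] := Q_SO3 p clp.
  apply: (det1_fixed_plane_trace detQ Fv (Qc p clp)).
  apply: cross_orthogonal_neq0.
  (* The Jacobi matrix of [y0] has full column rank, so the fixed tangent vector is nonzero. *)
  - apply: contraNneq v0 => Jv.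
    have Jfree : row_free (jacobi om y0 p)^T by rewrite /row_free mxrank_tr y0_rank.
    rewrite -[v]trmxK -[0]trmx0; apply/eqP; congr trmx.
    by apply: (row_free_inj Jfree); rewrite mul0mx -trmx_mul Jv trmx0.
  - exact/rank2_cross_neq0/y0_rank.
  - exact: cross_mul_orthogonal.
have trQ x : closure om x -> \tr (Q x) = 3.
  (* The whole plane is a neighbourhood of [p], a closure point of [om]; hence [om] contains some
     [z], which serves as base point. *)
  have [z [omz _]] := clp _ (@filterT _ (nbhs p) _).
  have trz y : closure om y -> \tr (Q y) = \tr (Q z).
    apply: (@eq_on_closure _ _ om (fun x => \tr (Q x)) (cst (\tr (Q z)))).
    - exact: norm_hausdorff.
    - exact: trQ_cont.
    - by move=> ?; exact: (@cst_continuous _ R).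
    - by move=> w omw; exact: trQ_const.
  by move=> clx; rewrite trz// -(trz p)// trQp.
have Q1 x : closure om x -> Q x = 1%:M.
  move=> clx; apply: orthogonal_trace_eq1; last exact: trQ.
  by case: (Q_SO3 x clx).
have diff_const k : forall x y, om x -> om y ->
    m x k 0 - y0 x k 0 = m y k 0 - y0 y k 0.
  apply: (@C1_partials0_constant R om (fun x => m x k 0 - y0 x k 0)) => // z omz i.
  have dm := (C1_closure_entry k 0 om_open m_C1 omz i).1.
  have dy := (C1_closure_entry k 0 om_open y0_C1 omz i).1.
  apply: is_derive_eq (is_deriveB dm dy) _.
  by rewrite -!jacobi_entry Dm_eq ?Q1 ?mul1mx ?subrr//; exact: om_cl.
have [z [omz _]] := clp _ (@filterT _ (nbhs p) _).
have diff_z k x : closure om x -> m x k 0 - y0 x k 0 = m z k 0 - y0 z k 0.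
  apply: (@eq_on_closure _ _ om (fun x => m x k 0 - y0 x k 0)
    (cst (m z k 0 - y0 z k 0))); first exact: norm_hausdorff.
  - exact: myk.
  - by move=> ?; exact: (@cst_continuous _ R).
  - by move=> y omy; exact: diff_const.
(* Each coordinate of [m - y0] is constant on [closure om] and vanishes at [p]. *)
move=> x clx; apply/colP => k; apply/eqP; rewrite -subr_eq0.
by rewrite diff_z// -(diff_z k p clp) m_eq_gamma// subrr.
Qed.
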